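(* Let $E$ be a non-zero Banach space and let $a$ be a nonzero element of $E$. Let $U_a:=\{\star\in\mathrm{Mltp}(E):a\in\mathrm{Inv}(E,\star)\}$. Then $U_a$ is open in $\mathrm{Mltp}_{\mathrm{u}}(E)$ and the map $\star\mapsto a_\star^{-1}$ from $U_a$ to $E$ is continuous.
   Context: $\mathrm{B}_2(E)$ is the Banach space of bounded bilinear maps $E\times E\to E$ with the operator norm $|\varphi|=\sup\{\|\varphi(x,y)\|:\|x\|\leq1,\|y\|\leq1\}$. $\mathrm{Mltp}(E)\subset\mathrm{B}_2(E)$ is the set of continuous multiplications on $E$, i.e. of those $*\in\mathrm{B}_2(E)$ that are associative as binary operations on $E$. $\mathrm{Mltp}_{\mathrm{u}}(E)\subset\mathrm{Mltp}(E)$ is the subset of unital ones, i.e. those for which $(E,* )$ has a (two-sided) unit element. All these sets carry the subspace topology from $\mathrm{B}_2(E)$. $\mathrm{Inv}(E,\star)$, the set of invertible elements of $(E,\star)$, is considered only for unital $\star$ (so the condition $a\in\mathrm{Inv}(E,\star)$ includes that $\star$ is unital), and $a^{-1}_\star$ is the inverse of $a\in\mathrm{Inv}(E,\star)$ with respect to $\star$. *)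

(* Defs.v *)
From HB Require Import structures.
From mathcomp Require Import all_boot all_order all_algebra.
From mathcomp Require Import all_classical all_reals all_analysis.
From mathcomp Require Export complex.

Set Implicit Arguments.
Unset Strict Implicit.
Unset Printing Implicit Defensive.

Import Order.TTheory GRing.Theory Num.Theory.
Import numFieldNormedType.Exports.

Local Open Scope classical_set_scope.
Local Open Scope ring_scope.
Local Open Scope complex_scope.

Variant scalar_kind := RealScalars | ComplexScalars.

(* As in every numFieldType, norms over R[i] take their values in R[i]: they
   are nonnegative for its partial order, hence real. *)
Definition scalar_field (R : realType) (k : scalar_kind) : numFieldType :=
  match k with RealScalars => R | ComplexScalars => R[i] end.

(* The order of R[i] is not total, so that the library's [sup] on realType
   does not apply to [scalar_field R k]; this is what replaces it. *)
Lemma scalar_supremums (R : realType) (k : scalar_kind) (A : set (scalar_field R k)) :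
  A !=set0 -> (forall r, A r -> 0 <= r) -> has_ubound A ->
  supremums A !=set0.
Proof.
case: k A => /= A [r0 Ar0] A0 [M AM].
  have hA : has_sup A by split; [exists r0 | exists M].
  exists (sup A); split; first exact: sup_upper_bound.
  by move=> N AN; apply: ge_sup => //; exists r0.
have realA r : A r -> r = (complex.Re r)%:C.
  by move=> /A0; case: r => a b /=; rewrite lecE /= => /andP[/eqP -> _].
have hA : has_sup [set complex.Re r | r in A].
  split; first by exists (complex.Re r0), r0.
  exists (complex.Re M) => _ [r Ar <-].
  by have := AM _ Ar; rewrite lecE => /andP[].
exists (sup [set complex.Re r | r in A])%:C; split.
  move=> r Ar; rewrite (realA _ Ar) lecR.
  by apply: sup_upper_bound => //; exists r.
move=> N AN.
have N0 : 0 <= N by apply: le_trans (AN _ Ar0); exact: A0.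
have -> : N = (complex.Re N)%:C.
  by case: N N0 {AN} => a b; rewrite lecE /= => /andP[/eqP -> _].
rewrite lecR; apply: ge_sup; first by exists (complex.Re r0), r0.
by move=> _ [r Ar <-]; have := AN _ Ar; rewrite lecE => /andP[].
Qed.

Section BoundedBilinear.
Context {R : realType} {k : scalar_kind}.
Local Notation K := (scalar_field R k).
Variable E : normedModType K.
Implicit Types f g : E -> E -> E.

Definition is_bilinear f :=
  (forall y, linear (fun x => f x y)) /\ (forall x, linear (f x)).

Definition unit_ball_norms f : set K :=
  [set r | exists x y, [/\ `|x| <= 1, `|y| <= 1 & r = `|f x y|]].

Definition bounded_bilinear : {pred E -> E -> E} :=
  fun f => `[< is_bilinear f /\ has_ubound (unit_ball_norms f) >].

Definition opnorm f : K := supremum 0 (unit_ball_norms f).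

Record B2 := MkB2 { B2_fun :> E -> E -> E ; B2P : B2_fun \in bounded_bilinear }.

HB.instance Definition _ := [isSub for B2_fun].
HB.instance Definition _ := [Choice of B2 by <:].

Lemma bounded_bilinear_submod : submod_closed bounded_bilinear.
Proof.
split.
  apply/asboolP; split; first by split=> z c x y; rewrite /= scaler0 addr0.
  by exists 0 => _ [x [y [_ _ ->]]] /=; rewrite normr0.
move=> c f g /asboolP[[fl fr] [M fM]] /asboolP[[gl gr] [N gN]].
apply/asboolP; split.
  split=> [y|x] a u v.
    change (c *: f (a *: u + v) y + g (a *: u + v) y
            = a *: (c *: f u y + g u y) + (c *: f v y + g v y)).
    by rewrite fl gl !scalerDr addrACA !scalerA (mulrC c).
  change (c *: f x (a *: u + v) + g x (a *: u + v)
          = a *: (c *: f x u + g x u) + (c *: f x v + g x v)).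
  by rewrite fr gr !scalerDr addrACA !scalerA (mulrC c).
exists (`|c| * M + N) => _ [x [y [x1 y1 ->]]].
rewrite (le_trans (ler_normD _ _))// lerD//; last by apply: gN; exists x, y.
by rewrite normrZ ler_wpM2l//; apply: fM; exists x, y.
Qed.

HB.instance Definition _ :=
  GRing.isSubmodClosed.Build K (E -> E -> E) bounded_bilinear
    bounded_bilinear_submod.
HB.instance Definition _ := [SubChoice_isSubLmodule of B2 by <:].

Lemma B2_addE (f g : B2) x y : (f + g) x y = f x y + g x y.
Proof. by []. Qed.

Lemma B2_oppE (f : B2) x y : (- f) x y = - f x y.
Proof. by []. Qed.

Lemma B2_scaleE c (f : B2) x y : (c *: f) x y = c *: f x y.
Proof. by []. Qed.

Lemma B2_ext (f g : B2) : (forall x y, f x y = g x y) -> f = g.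
Proof.
by move=> fg; apply/val_inj/funext => x; apply/funext => y; exact: fg.
Qed.

Lemma B2_bilinear (f : B2) : is_bilinear f.
Proof. by case: f => f /= /asboolP[]. Qed.

Lemma opnorm_supremums (f : B2) : supremums (unit_ball_norms f) (opnorm f).
Proof.
have ne : unit_ball_norms f !=set0.
  by exists `|f 0 0|, 0, 0; rewrite !normr0 ler01.
rewrite /opnorm /supremum; case: ifPn => [/eqP f0|_].
  by move: ne; rewrite f0 => -[].
have [s fs] : supremums (unit_ball_norms f) !=set0.
  apply: scalar_supremums => //; first by move=> _ [x [y [_ _ ->]]].
  by case: f {ne} => f /= /asboolP[].
by apply: (xgetPex 0); exists s.
Qed.

Lemma opnorm_ge0 (f : B2) : 0 <= opnorm f.
Proof.
have [fub _] := opnorm_supremums f.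
by apply: (le_trans (normr_ge0 (f 0 0))); apply: fub; exists 0, 0; rewrite normr0 ler01.
Qed.

Lemma B2_0l (f : B2) y : f 0 y = 0.
Proof.
have [fl _] := B2_bilinear f; apply: (addrI (f 0 y)).
by have := fl y 1 0 0; rewrite !scale1r !addr0.
Qed.

Lemma B2_0r (f : B2) x : f x 0 = 0.
Proof.
have [_ fr] := B2_bilinear f; apply: (addrI (f x 0)).
by have := fr x 1 0 0; rewrite !scale1r !addr0.
Qed.

Lemma B2_scalel (f : B2) c x y : f (c *: x) y = c *: f x y.
Proof.
have [fl _] := B2_bilinear f.
by have := fl y c x 0; rewrite B2_0l !addr0.
Qed.

Lemma B2_scaler (f : B2) c x y : f x (c *: y) = c *: f x y.
Proof.
have [_ fr] := B2_bilinear f.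
by have := fr x c y 0; rewrite B2_0r !addr0.
Qed.

Lemma ler_opnorm (f : B2) x y : `|f x y| <= opnorm f * `|x| * `|y|.
Proof.
have [->|x0] := eqVneq x 0; first by rewrite B2_0l !normr0 mulr0 mul0r.
have [->|y0] := eqVneq y 0; first by rewrite B2_0r !normr0 mulr0.
have [fub _] := opnorm_supremums f.
have : `|f (`|x|^-1 *: x) (`|y|^-1 *: y)| <= opnorm f.
  apply: fub; exists (`|x|^-1 *: x), (`|y|^-1 *: y).
  by split=> //; rewrite normrZ normfV normr_id mulVf ?normr_eq0.
rewrite B2_scalel B2_scaler !normrZ !normfV !normr_id.
rewrite ler_pdivrMl ?normr_gt0// ler_pdivrMl ?normr_gt0//.
by rewrite mulrA mulrC (mulrC `|y|) mulrA.
Qed.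

Lemma opnorm_le (f : B2) M :
  (forall x y, `|x| <= 1 -> `|y| <= 1 -> `|f x y| <= M) -> opnorm f <= M.
Proof.
have [_ flub] := opnorm_supremums f.
by move=> fM; apply: flub => _ [x [y [x1 y1 ->]]]; exact: fM.
Qed.

Lemma ler_opnorm1 (f : B2) x y :
  `|x| <= 1 -> `|y| <= 1 -> `|f x y| <= opnorm f.
Proof.
by have [fub _] := opnorm_supremums f; move=> x1 y1; apply: fub; exists x, y.
Qed.

Lemma opnormD (f g : B2) : opnorm (f + g) <= opnorm f + opnorm g.
Proof.
apply: opnorm_le => x y x1 y1; rewrite B2_addE.
by rewrite (le_trans (ler_normD _ _))// lerD// ler_opnorm1.
Qed.

Lemma opnormZ c (f : B2) : opnorm (c *: f) = `|c| * opnorm f.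
Proof.
apply: le_anti; apply/andP; split.
  apply: opnorm_le => x y x1 y1; rewrite B2_scaleE normrZ.
  by rewrite ler_wpM2l// ler_opnorm1.
have [->|c0] := eqVneq c 0; first by rewrite normr0 mul0r opnorm_ge0.
rewrite -ler_pdivlMl ?normr_gt0//; apply: opnorm_le => x y x1 y1.
rewrite ler_pdivlMl ?normr_gt0// -normrZ -B2_scaleE.
exact: ler_opnorm1.
Qed.

Lemma opnorm0_eq0 (f : B2) : opnorm f = 0 -> f = 0.
Proof.
move=> f0; apply: B2_ext => x y; apply/eqP; rewrite -normr_le0.
by have := ler_opnorm f x y; rewrite f0 !mul0r.
Qed.

HB.instance Definition _ :=
  Lmodule_isNormed.Build K B2 opnormD opnormZ opnorm0_eq0.

Lemma B2_normE (f : B2) : `|f| = opnorm f.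
Proof. by []. Qed.

Definition is_unit_of (s : B2) (e : E) := forall x, s e x = x /\ s x e = x.

Definition is_inverse_of (s : B2) (a b : E) :=
  exists e, [/\ is_unit_of s e, s a b = e & s b a = e].

Definition Mltp : set B2 := [set s : B2 | associative s].

Definition Mltpu : set B2 := Mltp `&` [set s | exists e, is_unit_of s e].

(* Empty when [s] has no unit. *)
Definition Inv (s : B2) : set E := [set a | exists b, is_inverse_of s a b].

(* Two-sided inverses are unique for [s] in [Mltp]; the value is 0 if [a] is
   not in [Inv s]. *)
Definition inv_of (s : B2) (a : E) : E := xget 0 (is_inverse_of s a).

Definition U_at (a : E) : set B2 := Mltp `&` [set s | Inv s a].

End BoundedBilinear.

Arguments Mltp {R k} E.
Arguments Mltpu {R k} E.

(* Main.v *)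
Require Import Defs.
From mathcomp Require Import all_boot all_order all_algebra.
From mathcomp Require Import all_classical all_reals all_analysis.
From mathcomp Require Import ring.
Import numFieldNormedType.Exports.
Local Open Scope classical_set_scope.
Local Open Scope ring_scope.
Import Order.TTheory GRing.Theory Num.Theory.

(** Fix a multiplication [s0] with unit [e0] in which [a] has the inverse [b0].
    The left translation [s0 a] is a bijection of [E] with bounded inverse
    [s0 b0], and [s a] differs from it by an operator of norm at most
    [`|s - s0| * `|a|]. When [s] is close to [s0], the equation [s a x = z] is
    therefore the fixed-point equation of a contraction of the complete space
    [E], so that [s a] is onto ([perturbation_onto]); so is the right
    translation [s ^~ a], for the same reason. If moreover [s] is associative
    and has a unit, [a] has a right and a left inverse in [s], hence is
    invertible: this is the openness.

    A solution [x] of [s a x = z] also depends on [s] and [z] in a Lipschitz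
    way near [s0] ([perturbation_dist]). The unit [e] of [s] solves [s a e = a],
    so it is close to [e0]; the inverse [b] of [a] solves [s a b = e], so it is
    in turn close to [b0]: this is the continuity. *)

(** * Fixed points of contractions over the real or complex numbers *)

(** The complex numbers are not a totally ordered archimedean field, but norms
    are real. *)
Lemma scalar_archi (R : realType) (k : scalar_kind) (x : scalar_field R k) :
  exists n, `|x| < n%:R.
Proof.
case: k x => /= x; first by exists (Num.truncn `|x|).+1; exact: truncnS_gt.
have -> : `|x| = (complex.Re `|x|)%:C%C.
  have : 0 <= `|x| by [].
  by case: (`|x|) => u v; rewrite lecE /= => /andP[/eqP -> _].
exists (Num.truncn (complex.Re `|x|)).+1.
rewrite -(rmorph_nat (real_complex R)) ltcR.
exact: truncnS_gt.
Qed.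

Lemma half_expn_lt (K : numFieldType) (C e : K) :
    (forall x : K, exists n, `|x| < n%:R) -> 0 <= C -> 0 < e ->
  exists n, C * 2^-1 ^+ n < e.
Proof.
move=> archi C0 e0; have [n] := archi (C / e).
rewrite ger0_norm; last by rewrite divr_ge0// ltW.
rewrite ltr_pdivrMr// => Cn; exists n.
rewrite exprVn ltr_pdivrMr ?exprn_gt0// (lt_trans Cn)// mulrC ltr_pM2l//.
by rewrite -natrX ltr_nat ltn_expl.
Qed.

(** The argument is Banach's, with geometric estimates that only need norms of
    scalars to be archimedean: the orbit of 0 moves by at most
    [`|T 0| * 2] in total, and by half as much after each step. *)
Lemma half_contraction_fixpoint (K : numFieldType)
    (E : completeNormedModType K) (T : E -> E) :
    (forall x : K, exists n, `|x| < n%:R) ->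
    (forall x y, `|T x - T y| <= 2^-1 * `|x - y|) ->
  exists p, T p = p.
Proof.
move=> archi lipT.
pose u n := iter n T 0; pose C := `|T 0| * 2.
have C0 : 0 <= C by rewrite mulr_ge0.
have u0 m : `|u m - u 0%N| <= C.
  elim: m => [|m IH]; first by rewrite subrr normr0.
  rewrite -(subrK (T (u 0%N)) (u m.+1)) -addrA.
  apply: le_trans (ler_normD _ _) _.
  rewrite /C mulr_natr mulr2n lerD//; last by rewrite subr0.
  apply: le_trans (lipT _ _) _.
  by rewrite mulrC ler_pdivrMr.
have un n m : `|u (n + m)%N - u n| <= C * 2^-1 ^+ n.
  elim: n => [|n IH]; first by rewrite add0n expr0 mulr1.
  rewrite exprS mulrCA addSn; apply: le_trans (lipT _ _) _.
  by rewrite ler_wpM2l.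
have /cauchy_cvgP/cvg_ex[p up] : cauchy (u @ \oo).
  apply: cauchy_exP => e e0; have [n Cn] := half_expn_lt K C e archi C0 e0.
  exists (u n); exists n => // m /= nm.
  rewrite -ball_normE /= distrC; apply: le_lt_trans Cn.
  by rewrite -(subnKC nm).
exists p; apply/eqP; rewrite -subr_eq0 -normr_eq0; apply/eqP.
apply/le_anti; rewrite normr_ge0 andbT.
apply/ler_addgt0Pr => e e0; rewrite add0r (splitr e).
have e2 : 0 < e / 2 by rewrite divr_gt0.
near \oo => n.
rewrite -(subrK (u n.+1) (T p)) -addrA; apply: le_trans (ler_normD _ _) _.
rewrite lerD//; last first.
  rewrite distrC; near: n; apply: (cvgr_dist_le (u \o S)) => //.
  by rewrite cvg_shiftS.
apply: le_trans (lipT _ _) _.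
rewrite mulrC ler_pdivrMr// mulrAC -mulrA mulfV ?mulr1 ?pnatr_eq0//.
apply: (@le_trans _ _ (e / 2)).
  by near: n; apply: (cvgr_dist_le u).
by rewrite ler_pdivrMr// ler_peMr ?ler1n// ltW.
Unshelve. all: by end_near. Qed.

(** * Perturbations of a bijection with bounded inverse *)

(** As [h] is injective, [g x = z] amounts to [x] being fixed by
    [x |-> x - h (g x - z)]. The images of [x] and [y] under this map differ by
    [h ((f - g) (x - y))], so it is a contraction. *)
Lemma perturbation_onto (K : numFieldType) (E : completeNormedModType K)
    (f g h : E -> E) (N eta : K) :
    (forall x : K, exists n, `|x| < n%:R) ->
    zmod_morphism f -> zmod_morphism g -> zmod_morphism h ->
    cancel f h -> cancel h f -> 0 <= N ->
    (forall x, `|h x| <= N * `|x|) ->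
    (forall x, `|g x - f x| <= eta * `|x|) ->
    N * eta <= 2^-1 ->
  forall z, exists x, g x = z.
Proof.
move=> archi fB gB hB fK hK N0 hN gf small z.
have [x y|x xfix] :=
    @half_contraction_fixpoint K E (fun x => x - h (g x - z)) archi.
  have -> : x - h (g x - z) - (y - h (g y - z)) =
            x - y - (h (g x - z) - h (g y - z)).
    by rewrite !opprD addrACA.
  rewrite -hB opprD opprK addrACA addNr addr0 -gB -{1}(fK (x - y)) -hB.
  apply: le_trans (hN _) _; rewrite distrC.
  apply: le_trans (ler_wpM2l N0 (gf _)) _.
  by rewrite mulrA ler_wpM2r.
have h0 : h (g x - z) = 0.
  by apply/oppr_inj/(addrI x); rewrite xfix oppr0 addr0.
have f0 : f 0 = 0 by have := fB 0 0; rewrite !subrr.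
by exists x; apply/eqP; rewrite -subr_eq0 -(hK (g x - z)) h0 f0.
Qed.

(** As [x - x0 = h (f x - f x0)] and [f x] is close to [g x], the size of
    [g x - f x0] controls [x - x0]; half of [`|x - x0|] absorbs the part of the error that depends
    on [x]. *)
Lemma perturbation_dist (K : numFieldType) (E : normedModType K)
    (f g h : E -> E) (N eta : K) (x x0 : E) :
    zmod_morphism h -> cancel f h -> 0 <= N -> 0 <= eta ->
    (forall x, `|h x| <= N * `|x|) ->
    (forall x, `|g x - f x| <= eta * `|x|) ->
    N * eta <= 2^-1 ->
  `|x - x0| <= 2 * N * (`|g x - f x0| + eta * `|x0|).
Proof.
move=> hB fK N0 eta0 hN gf small.
have xx0 : `|x - x0| <=
    N * (`|g x - f x0| + eta * `|x0|) + 2^-1 * `|x - x0|.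
  rewrite -{1}(fK x) -{1}(fK x0) -hB; apply: le_trans (hN _) _.
  apply: (@le_trans _ _
    (N * (`|g x - f x0| + eta * (`|x0| + `|x - x0|)))).
    rewrite ler_wpM2l// -(subrK (g x) (f x)) -addrA addrC.
    apply: le_trans (ler_normD _ _) _; rewrite lerD// distrC.
    apply: le_trans (gf _) _; rewrite ler_wpM2l//.
    by rewrite -{1}(subrK x0 x) addrC ler_normD.
  rewrite (mulrDr eta) addrA mulrDr lerD// mulrA ler_wpM2r//.
move: xx0; rewrite -lerBlDr -{1}(mul1r `|x - x0|) -mulrBl.
have -> : 1 - 2^-1 = 2^-1 :> K by rewrite {1}(splitr 1) mul1r addrK.
by rewrite ler_pdivrMl// mulrA.
Qed.

(** * Multiplications near one in which a is invertible *)

Section Multiplications.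
Context {R : realType} {k : scalar_kind}.
Local Notation K := (scalar_field R k).

Lemma B2_subl {E : normedModType K} (s : B2 E) y :
  zmod_morphism (fun x => s x y).
Proof.
move=> x x'; have [sl _] := B2_bilinear s.
by rewrite addrC -scaleN1r sl scaleN1r addrC.
Qed.

Lemma B2_subr {E : normedModType K} (s : B2 E) x : zmod_morphism (s x).
Proof.
move=> y y'; have [_ sr] := B2_bilinear s.
by rewrite addrC -scaleN1r sr scaleN1r addrC.
Qed.

Lemma B2_distl {E : normedModType K} (s s0 : B2 E) a x :
  `|s a x - s0 a x| <= `|s - s0| * `|a| * `|x|.
Proof. exact: (ler_opnorm (s - s0)). Qed.

Lemma B2_distr {E : normedModType K} (s s0 : B2 E) a x :
  `|s x a - s0 x a| <= `|s - s0| * `|a| * `|x|.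
Proof. by rewrite mulrAC; exact: (ler_opnorm (s - s0)). Qed.

Lemma inverse_cancel {E : normedModType K} (s : B2 E) a b :
    associative s -> is_inverse_of s a b ->
  [/\ cancel (s a) (s b), cancel (s b) (s a),
      cancel (s^~ a) (s^~ b) & cancel (s^~ b) (s^~ a)].
Proof.
move=> sA [e [eu sab sba]]; split => x /=.
- by rewrite sA sba; have [] := eu x.
- by rewrite sA sab; have [] := eu x.
- by rewrite -sA sab; have [] := eu x.
- by rewrite -sA sba; have [] := eu x.
Qed.

Lemma Inv_of_onto {E : normedModType K} (s : B2 E) a :
    Mltpu E s -> (forall z, exists x, s a x = z) ->
    (forall z, exists x, s x a = z) ->
  Defs.Inv s a.
Proof.
move=> [sA [e eu]] onl onr.
have [b sab] := onl e; have [c sca] := onr e.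
(* a left and a right inverse of [a] coincide *)
have cb : c = b.
  by rewrite -[LHS](eu c).2 -sab sA sca (eu b).1.
by exists b, e; split=> //; rewrite -cb.
Qed.

Lemma inv_ofP {E : normedModType K} (s : B2 E) a :
  Defs.Inv s a -> is_inverse_of s a (inv_of s a).
Proof. by move=> sa; apply: (xgetPex 0). Qed.

Lemma near_distM (E : normedModType K) (s0 : B2 E) (C e : K) :
  0 <= C -> 0 < e -> \forall s \near s0, C * `|s - s0| <= e.
Proof.
move=> C0 e0; have C1 : 0 < C + 1 by rewrite ltr_wpDl.
near=> s; apply: (@le_trans _ _ ((C + 1) * `|s - s0|)).
  by rewrite ler_wpM2r// lerDl.
rewrite -ler_pdivlMl// mulrC distrC.
by near: s; apply: cvgr_dist_le => //; rewrite divr_gt0.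
Unshelve. all: by end_near. Qed.

Lemma near_perturbation_small (E : normedModType K) (s0 : B2 E) (a b : E) :
  \forall s \near s0, `|s0| * `|b| * (`|s - s0| * `|a|) <= 2^-1.
Proof.
apply: filterS (near_distM E s0 (`|s0| * `|b| * `|a|) 2^-1 _ _) => //.
by move=> s; rewrite mulrA mulrAC.
Qed.

Lemma near_Inv (E : completeNormedModType K) (s0 : B2 E) (a : E) :
  U_at a s0 -> \forall s \near s0, Mltpu E s -> Defs.Inv s a.
Proof.
move=> [s0A [b s0b]].
have [abK baK acK caK] := inverse_cancel s0 a b s0A s0b.
have N0 : 0 <= `|s0| * `|b| by rewrite mulr_ge0.
apply: filterS (near_perturbation_small E s0 a b) => s small sU.
apply: Inv_of_onto => //.
  apply: (perturbation_onto K E (s0 a) (s a) (s0 b)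
    (`|s0| * `|b|) (`|s - s0| * `|a|) (@scalar_archi R k)) => //.
  - exact: B2_subr.
  - exact: B2_subr.
  - exact: B2_subr.
  - by move=> x; exact: ler_opnorm.
  - exact: B2_distl.
apply: (perturbation_onto K E (s0^~ a) (s^~ a) (s0^~ b)
  (`|s0| * `|b|) (`|s - s0| * `|a|) (@scalar_archi R k)) => //.
- exact: B2_subl.
- exact: B2_subl.
- exact: B2_subl.
- by move=> x; rewrite mulrAC; exact: ler_opnorm.
- exact: B2_distr.
Qed.

(** The constant comes from two applications of [perturbation_dist]: the first
    bounds the distance between the units of [s] and [s0], which solve
    [s a x = a] and [s0 a x = a]; the second one, the distance between the
    inverses of [a], which [s a] and [s0 a] map to these units. *)
Lemma inv_of_lipschitz (E : normedModType K) (s0 : B2 E) (a : E) :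
  U_at a s0 -> exists2 C : K, 0 <= C &
    \forall s \near s0, U_at a s ->
      `|inv_of s a - inv_of s0 a| <= C * `|s - s0|.
Proof.
move=> [s0A /inv_ofP s0b]; set b0 := inv_of s0 a in s0b *.
have [abK _ _ _] := inverse_cancel s0 a b0 s0A s0b.
have [e0 [e0u s0ab0 _]] := s0b.
pose N := `|s0| * `|b0|; have N0 : 0 <= N by rewrite mulr_ge0.
exists (2 * N * (2 * N * `|e0| + `|b0|) * `|a|).
  by rewrite !mulr_ge0// addr_ge0// !mulr_ge0.
apply: filterS (near_perturbation_small E s0 a b0) => s small.
move=> [sA /inv_ofP[e [eu sab _]]].
set b := inv_of s a in sab *.
pose eta := `|s - s0| * `|a|.
have sol_dist x x0 : `|x - x0| <= 2 * N * (`|s a x - s0 a x0| + eta * `|x0|).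
  apply: (perturbation_dist K E (s0 a) (s a) (s0 b0)) => //.
  - exact: B2_subr.
  - by rewrite mulr_ge0.
  - by move=> y; exact: ler_opnorm.
  - exact: B2_distl.
have ee0 : `|e - e0| <= 2 * N * (eta * `|e0|).
  by have := sol_dist e e0; rewrite (eu a).2 (e0u a).2 subrr normr0 add0r.
apply: le_trans (sol_dist b b0) _; rewrite sab s0ab0.
have -> : 2 * N * (2 * N * `|e0| + `|b0|) * `|a| * `|s - s0| =
          2 * N * (2 * N * (eta * `|e0|) + eta * `|b0|).
  rewrite /eta; ring.
by rewrite ler_wpM2l ?mulr_ge0// lerD2r.
Qed.

End Multiplications.

Theorem theorem3p5 (R : realType) (k : scalar_kind)
    (E : completeNormedModType (scalar_field R k))
    (hE : exists x : E, x != 0) (a : E) (ha : a != 0) :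
  [/\ U_at a `<=` Mltpu E,
      open (U_at a : set (subspace (Mltpu E))) &
      {within U_at a, continuous (fun s : B2 E => inv_of s a)}].
Proof.
have UM : U_at a `<=` Mltpu E.
  by move=> s [sA [b [e [eu _ _]]]]; split=> //; exists e.
split=> //.
  move=> s0 s0U; apply/nbhs_subspace_ex; first exact: UM.
  exists [set s | Mltpu E s -> Defs.Inv s a]; first exact: near_Inv.
  apply/seteqP; split=> s [sU sM]; split=> //; first by move=> _; case: sU.
  by split; [case: sM | exact: sU].
apply/subspace_continuousP => s0 s0U.
apply/cvgrPdist_le => e e0.
have [C C0 lip] := inv_of_lipschitz E s0 a s0U.
apply: filterS2 lip (near_distM E s0 C e C0 e0) => s lip small sU.
by rewrite distrC; apply: le_trans (lip sU) _.
Qed.
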